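(* Let $n$ be a natural number, let $\Vdash_n$ be any one of $\models_n$, $\models^\alpha_n$, $\models^s_n$, and let $\Sigma$ be a system. If $\Sigma$ is base-sound over $\Vdash_n$, enjoys the compact export principle and does not derive Harrop's rule, then $\Sigma$ is not base-complete over $\Vdash_n$.
   Context: LANGUAGE. $\mathscr{L}$ is the propositional language whose formulas are built from infinitely many propositional letters and the atomic constant $\bot$ by $\wedge,\vee,\rightarrow$; $\neg X := X \rightarrow \bot$. $\mathrm{ATOM}$ is the set of the letters together with $\bot$. $\Gamma,\Delta$ always range over finite sets of formulas. ATOMIC RULES. A rule of level $0$ is an atom (an axiom). A rule of level $1$ infers an atom $A$ from atoms $A_1,\dots,A_m$. For $k\ge 1$, if $\Re_1,\dots,\Re_m$ are finite sets of atomic rules (some possibly empty) of maximal level $k-1$, then $([\Re_1]A_1,\dots,[\Re_m]A_m)/A$, which infers the atom $A$ from the atoms $A_1,\dots,A_m$ and discharges the rules in $\Re_i$ in the derivation of the $i$-th premise, is a rule of level $k+1$. ATOMIC BASES. An atomic base is a (possibly infinite) set $\mathfrak{B}$ of atomic rules containing the explosion rule $\bot/A$ for every atom $A$; its level is the maximal level of its rules other than the explosion rules ($0$ if there are none). $\mathbb{B}^n$ is the set of bases of level $\le n$. $\mathfrak{C}\supseteq_n\mathfrak{B}$ means $\mathfrak{C}\supseteq\mathfrak{B}$ and $\mathfrak{C}\in\mathbb{B}^n$. Derivations in $\mathfrak{B}$ are defined inductively: an atom $A$ is a single-node derivation of $A$, from no assumed rules if the axiom $A\in\mathfrak{B}$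 is applied, and from the assumed rule $A$ if $A$ is assumed; if $\mathscr{D}_i$ derives $A_i$ from assumed rules $\mathfrak{C}_i\cup\Re_i$ ($i\le m$), then applying $R=([\Re_1]A_1,\dots,[\Re_m]A_m)/A$ yields a derivation of $A$ from $\bigcup_i\mathfrak{C}_i$ if $R\in\mathfrak{B}$, and from $\bigcup_i\mathfrak{C}_i\cup\{R\}$ if $R\notin\mathfrak{B}$. $\vdash_{\mathfrak{B}}A$ means that there is a derivation of $A$ in $\mathfrak{B}$ from no assumed rules (a closed derivation). STANDARD BASE SEMANTICS. For $\mathfrak{B}\in\mathbb{B}^n$, define: for $A\in\mathrm{ATOM}$, $\models_{\mathfrak{B},n}A$ iff $\vdash_{\mathfrak{B}}A$; $\models_{\mathfrak{B},n}B\wedge C$ iff $\models_{\mathfrak{B},n}B$ and $\models_{\mathfrak{B},n}C$; $\models_{\mathfrak{B},n}B\vee C$ iff $\models_{\mathfrak{B},n}B$ or $\models_{\mathfrak{B},n}C$; $\models_{\mathfrak{B},n}B\rightarrow C$ iff $B\models_{\mathfrak{B},n}C$; for $\Gamma\ne\emptyset$, $\Gamma\models_{\mathfrak{B},n}A$ iff for all $\mathfrak{C}\supseteq_n\mathfrak{B}$, if $\models_{\mathfrak{C},n}B$ for all $B\in\Gamma$ then $\models_{\mathfrak{C},n}A$. SANDQVIST'S BASE SEMANTICS. $\models^s_{\mathfrak{B},n}$ is defined by the same clauses (with $\models^s$ in place of $\models$ throughout), except that $\models^s_{\mathfrak{B},n}B\vee C$ iff for all $\mathfrak{C}\supseteq_n\mathfrak{B}$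 and all $D\in\mathrm{ATOM}$, if $B\models^s_{\mathfrak{C},n}D$ and $C\models^s_{\mathfrak{C},n}D$ then $\models^s_{\mathfrak{C},n}D$. REDUCIBILITY SEMANTICS. An argument structure $\mathscr{D}=\langle T,\langle f,h,g\rangle\rangle$ consists of a finite rooted tree $T$ with nodes labelled by formulas ($\mu\prec\nu$ means that $\nu$ lies below $\mu$, towards the root), whose leaves are partitioned into assumption leaves $\mathrm{as}(T)$ and axiom leaves $\mathrm{ax}(T)$, and of partial discharge functions: $f$ is defined on a subset of $\mathrm{as}(T)$ with $\mu\prec f(\mu)$; $h$ is defined on a subset of $\mathrm{ax}(T)$ with $\mu\prec h(\mu)$, where $h(\mu)$ and its children are labelled by atoms and $h(\mu)$ is not a value of $f$; $g$ is defined on a set of sets $K$ of edges, each $K$ consisting of all and only the edges linking a node $\mu_K$ to its children, where $\mu_K$ and its children are labelled by atoms, $\mu_K$ is not a value of $f$, $\mu_K\prec g(K)$, $g(K)$ and its children are labelled by atoms, and $g(K)$ is not a value of $f$. ($f$ discharges assumptions; $h$ and $g$ discharge assumed atomic rules of level $0$ and higher.) The root label is the conclusion. $\mathscr{D}$ is from $\Gamma$ to $A$ if $\Gamma$ is the set of its undischarged assumptions and $A$ its conclusion; it is closed if $\Gamma=\emptyset$, open otherwise. Derivations in $\mathfrak{B}$ are regarded as argument structures with all labels atomic and $f$ empty. $\mathscr{D}[\mathscr{D}^{**}/\mathscr{D}^*]$ is the result of replacing the sub-structure $\mathscr{D}^*$ by $\mathscr{D}^{**}$ in $\mathscr{D}$,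 the discharge functions being redefined in the natural way (discharges of surviving or copied assumptions and assumed rules take place at the corresponding nodes; the others disappear). If $\mathscr{D}$ is from $\Gamma=\{\mu_1,\dots,\mu_m\}$ and $\sigma$ assigns to each $\mu_i$ an argument structure $\sigma(\mu_i)$ with the same conclusion as $\mu_i$, then $\mathscr{D}^\sigma=\mathscr{D}[\sigma(\mu_1),\dots,\sigma(\mu_m)/\mu_1,\dots,\mu_m]$; it is a closed $\sigma$-instance if all $\sigma(\mu_i)$ are closed. An inference is a triple $\langle\langle\mathscr{D}_1,\dots,\mathscr{D}_m\rangle,A,\delta\rangle$ with $\delta$ an extension of the discharge functions of the $\mathscr{D}_i$; its associated argument structure joins the trees of the $\mathscr{D}_i$ by a new root $A$ and adds the discharges $\delta$. A rule is a (recursive) set of inferences, its instances. Introduction rules are Gentzen's: $A,B/A\wedge B$; $A_i/A_1\vee A_2$ ($i=1,2$); $[A]B/A\rightarrow B$. $\mathscr{D}$ is canonical if it is associated to an instance of an introduction rule. A reduction for a rule $R$ is a map $\phi$ from and to argument structures, defined on some set $\mathbb{D}$ of argument structures associated to instances of $R$, such that for all $\mathscr{D}\in\mathbb{D}$: (a) if $\mathscr{D}$ is from $\Gamma$ to $A$, then $\phi(\mathscr{D})$ is from some $\Gamma^*\subseteq\Gamma$ to $A$; (b) for all $\sigma$, $\phi$ is defined on $\mathscr{D}^\sigma$ and $\phi(\mathscr{D}^\sigma)=\phi(\mathscr{D})^\sigma$. For a set $\mathfrak{J}$ of reductions, $\mathscr{D}\leq_{\mathfrak{J}}\mathscr{D}^*$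 is the reflexive-transitive closure of: $\mathscr{D}^*=\mathscr{D}[\phi(\mathscr{D}^{**})/\mathscr{D}^{**}]$ for some sub-structure $\mathscr{D}^{**}$ of $\mathscr{D}$ and some $\phi\in\mathfrak{J}$. An argument is a pair $\langle\mathscr{D},\mathfrak{J}\rangle$. It is $n$-valid on $\mathfrak{B}\in\mathbb{B}^n$ iff: when $\mathscr{D}$ is closed with atomic conclusion, $\mathscr{D}\leq_{\mathfrak{J}}\mathscr{D}^*$ for some closed derivation $\mathscr{D}^*$ in $\mathfrak{B}$; when $\mathscr{D}$ is closed with non-atomic conclusion, $\mathscr{D}\leq_{\mathfrak{J}}\mathscr{D}^*$ for some canonical $\mathscr{D}^*$ whose immediate sub-structures, paired with $\mathfrak{J}$, are $n$-valid on $\mathfrak{B}$; when $\mathscr{D}$ is open with undischarged assumptions $\Gamma$, for all $\sigma$ assigning closed structures, all sets of reductions $\mathfrak{J}^+\supseteq\mathfrak{J}$ and all $\mathfrak{C}\supseteq_n\mathfrak{B}$, if $\langle\sigma(\mu),\mathfrak{J}^+\rangle$ is $n$-valid on $\mathfrak{C}$ for all $\mu\in\Gamma$, then $\langle\mathscr{D}^\sigma,\mathfrak{J}^+\rangle$ is $n$-valid on $\mathfrak{C}$. $\Gamma\models^\alpha_{\mathfrak{B},n}A$ means that some argument $\langle\mathscr{D},\mathfrak{J}\rangle$ with $\mathscr{D}$ from $\Gamma$ to $A$ is $n$-valid on $\mathfrak{B}$. SYSTEMS. A system $\Sigma$ is a recursive set of super-intuitionistic rules over $\mathscr{L}$ (e.g.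 intuitionistic logic $\mathrm{IL}$); $\Gamma\vdash_\Sigma A$ is derivability in $\Sigma$. Extended derivations of $\Sigma$ are built inductively from single formulas (assumed, or, for atoms, possibly used as axioms) by the logical rules of $\Sigma$ in the standard way and by applications of arbitrary atomic rules $([\Re_1]A_1,\dots,[\Re_m]A_m)/B$, which discharge the rules $\Re_i$ used in the derivation of the $i$-th premise. $\Gamma\vdash_{\Sigma\cup\mathfrak{B}}A$ means that there is an extended derivation of $\Sigma$ from $\Gamma$ to $A$ whose only additional (undischarged) atomic rules are those in $\mathfrak{B}$. $\Sigma$ is base-complete over $\Vdash_n$ iff for all $\mathfrak{B}\in\mathbb{B}^n$, $\Gamma$ and $A$, $\Gamma\Vdash_{\mathfrak{B},n}A$ implies $\Gamma\vdash_{\Sigma\cup\mathfrak{B}}A$; it is base-sound over $\Vdash_n$ iff for all $\mathfrak{B}\in\mathbb{B}^n$, $\Gamma$ and $A$, $\Gamma\vdash_{\Sigma\cup\mathfrak{B}}A$ implies $\Gamma\Vdash_{\mathfrak{B},n}A$. COMPACT EXPORT AND HARROP'S RULE. To each atomic rule $R$ associate a disjunction-free formula $R^*$: $R^*=A$ if $R$ is the axiom $A$; if $R=([\Re_1]A_1,\dots,[\Re_m]A_m)/A$, then $R^*=\bigwedge_{i\le m}(\bigwedge_{\rho\in\Re_i}\rho^*\rightarrow A_i)\rightarrow A$, where the $i$-th conjunct is just $A_i$ if $\Re_i=\emptyset$. $\mathfrak{B}^*=\{R^*\mid R\in\mathfrak{B}\}$. $\Sigma$ enjoys the compact export principle iff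 for every atomic base $\mathfrak{B}$, every $\Gamma$ and every $A$: $\Gamma\vdash_{\Sigma\cup\mathfrak{B}}A$ iff there is a finite $\Delta\subseteq\mathfrak{B}^*$ such that $\Gamma,\Delta\vdash_\Sigma A$. Harrop's rule infers $(\neg A\rightarrow B)\vee(\neg A\rightarrow C)$ from $\neg A\rightarrow B\vee C$, for arbitrary formulas $A,B,C$. *)

(* Defs.v *)
From HB Require Import structures.
From mathcomp Require Import all_boot.
From Stdlib Require Import Relations.

Set Implicit Arguments.
Unset Strict Implicit.
Unset Printing Implicit Defensive.

(** * Formulas *)

(* [None] is the constant bottom, [Some k] is the [k]-th propositional letter. *)
Definition atom : Type := option nat.
Definition bot : atom := None.

Inductive form : Type :=
| Atom of atom
| And of form & form
| Or of form & form
| Imp of form & form.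

Fixpoint form_enc (F : form) : GenTree.tree atom :=
  match F with
  | Atom a => GenTree.Leaf a
  | And X Y => GenTree.Node 0 [:: form_enc X; form_enc Y]
  | Or X Y => GenTree.Node 1 [:: form_enc X; form_enc Y]
  | Imp X Y => GenTree.Node 2 [:: form_enc X; form_enc Y]
  end.

Fixpoint form_dec (t : GenTree.tree atom) : option form :=
  match t with
  | GenTree.Leaf a => Some (Atom a)
  | GenTree.Node k [:: x; y] =>
      match form_dec x, form_dec y, k with
      | Some X, Some Y, 0 => Some (And X Y)
      | Some X, Some Y, 1 => Some (Or X Y)
      | Some X, Some Y, 2 => Some (Imp X Y)
      | _, _, _ => None
      end
  | _ => None
  end.

Lemma form_encK : pcancel form_enc form_dec.
Proof. by elim=> [a|X /= -> Y ->|X /= -> Y ->|X /= -> Y ->]. Qed.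

HB.instance Definition _ := Countable.copy form (pcan_type form_encK).

Definition Neg (F : form) : form := Imp F (Atom bot).

Definition atomic (F : form) : bool := if F is Atom _ then true else false.

Fixpoint fsubst (s : nat -> form) (F : form) : form :=
  match F with
  | Atom None => Atom bot
  | Atom (Some k) => s k
  | And X Y => And (fsubst s X) (fsubst s Y)
  | Or X Y => Or (fsubst s X) (fsubst s Y)
  | Imp X Y => Imp (fsubst s X) (fsubst s Y)
  end.

(** * Recursive sets *)

Inductive recfun : Type :=
| RZero
| RSucc
| RProj of nat
| RComp of recfun & seq recfun
| RPrec of recfun & recfun
| RMu of recfun.

(* [eval f v y]: the partial recursive function [f] is defined on the argument
   list [v], with value [y]. *)
Inductive eval : recfun -> seq nat -> nat -> Prop :=
| eval_zero v : eval RZero v 0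
| eval_succ x v : eval RSucc (x :: v) x.+1
| eval_proj i v : eval (RProj i) v (nth 0 v i)
| eval_comp f gs v ws y :
    size ws = size gs ->
    (forall i, i < size gs -> eval (nth RZero gs i) v (nth 0 ws i)) ->
    eval f ws y -> eval (RComp f gs) v y
| eval_prec0 f g v y : eval f v y -> eval (RPrec f g) (0 :: v) y
| eval_precS f g k v y z :
    eval (RPrec f g) (k :: v) y -> eval g (k :: y :: v) z ->
    eval (RPrec f g) (k.+1 :: v) z
| eval_mu f v k (w : nat -> nat) :
    (forall j, j < k -> eval f (j :: v) (w j).+1) ->
    eval f (k :: v) 0 -> eval (RMu f) v k.

Definition recursive (T : countType) (P : T -> Prop) : Prop :=
  exists f : recfun, forall x : T,
    (P x -> eval f [:: pickle x] 1) /\ (~ P x -> eval f [:: pickle x] 0).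

(** * Atomic rules and bases *)

(* [ARule [:: (Re_1, A_1); ...; (Re_m, A_m)] A] is ([Re_1]A_1,...,[Re_m]A_m)/A;
   the case m = 0 is the axiom A.  The finite sets Re_i are presented by lists,
   and presentations are identified by [same_rule]. *)
Inductive arule : Type := ARule of seq (seq arule * atom) & atom.

Fixpoint same_rule (R S : arule) {struct R} : bool :=
  let: ARule ps a := R in
  let: ARule qs b := S in
  (a == b) &&
  all2 (fun p q =>
          [&& p.2 == q.2,
              all (fun r => has (same_rule r) q.1) p.1 &
              all (fun s => has (fun r => same_rule r s) p.1) q.1]) ps qs.

Fixpoint level (R : arule) : nat :=
  let: ARule ps _ := R in
  if ps is [::] then 0 else
  foldr maxn 1
    (map (fun p => foldr maxn 0 (map (fun r => (level r).+2) p.1)) ps).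

Definition explosion (a : atom) : arule := ARule [:: ([::], bot)] a.

Record base : Type := Base {
  base_rules :> arule -> Prop;
  base_ext : forall R S, same_rule R S -> base_rules R -> base_rules S;
  base_explosion : forall a, base_rules (explosion a)
}.

Definition in_level (n : nat) (B : base) : Prop :=
  forall R, B R -> (exists a, R = explosion a) \/ level R <= n.

Definition extends (n : nat) (B C : base) : Prop :=
  (forall R, B R -> C R) /\ in_level n C.

(** * Argument structures *)

(* The discharge functions are encoded by de Bruijn indices, index [k] at a
   node pointing to its [k]-th proper ancestor (0 is the parent).
   - [Asm A k] is an assumption leaf; f maps it to the ancestor [k].  If there
     is no such ancestor in the tree the assumption is undischarged, and the
     excess of [k] over the depth of the leaf identifies it.
   - [Axm A d] is an axiom leaf; [d = Some k] means that h maps it to the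
     ancestor [k], [d = None] that h is undefined on it.
   - [Node A d ts] is an inner node with immediate sub-structures [ts]; [d]
     gives likewise the value of g on the set of the edges to its children.
   A sub-structure is a subtree.  What is discharged outside of it occurs in it
   with an index exceeding the depth, which records the outer node where it is
   discharged; so discharges are kept when a sub-structure is replaced. *)
Inductive tree : Type :=
| Asm of form & nat
| Axm of form & option nat
| Node of form & option nat & seq tree.

Fixpoint tree_rect' (P : tree -> Type) (Q : seq tree -> Type)
    (hAsm : forall A k, P (Asm A k)) (hAxm : forall A d, P (Axm A d))
    (hNode : forall A d ts, Q ts -> P (Node A d ts))
    (hnil : Q [::]) (hcons : forall t ts, P t -> Q ts -> Q (t :: ts))
    (t : tree) : P t :=
  match t with
  | Asm A k => hAsm A k
  | Axm A d => hAxm A d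
  | Node A d ts => hNode A d ts
      ((fix loop ts := match ts return Q ts with
        | [::] => hnil
        | t :: ts => hcons t ts
            (tree_rect' hAsm hAxm hNode hnil hcons t) (loop ts)
        end) ts)
  end.

Fixpoint tree_enc (t : tree) : GenTree.tree (form * option nat) :=
  match t with
  | Asm A k => GenTree.Node 0 [:: GenTree.Leaf (A, Some k)]
  | Axm A d => GenTree.Node 1 [:: GenTree.Leaf (A, d)]
  | Node A d ts => GenTree.Node 2 (GenTree.Leaf (A, d) :: map tree_enc ts)
  end.

Fixpoint tree_dec (g : GenTree.tree (form * option nat)) : option tree :=
  match g with
  | GenTree.Node 0 [:: GenTree.Leaf (A, Some k)] => Some (Asm A k)
  | GenTree.Node 1 [:: GenTree.Leaf (A, d)] => Some (Axm A d)
  | GenTree.Node 2 (GenTree.Leaf (A, d) :: gs) =>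
      Some (Node A d (pmap tree_dec gs))
  | _ => None
  end.

Lemma tree_encK : pcancel tree_enc tree_dec.
Proof.
apply: (@tree_rect' (fun t => tree_dec (tree_enc t) = Some t)
  (fun ts => pmap tree_dec (map tree_enc ts) = ts)) => //= [A d ts ->|t ts ->] //.
by move=> /= ->.
Qed.

HB.instance Definition _ := Countable.copy tree (pcan_type tree_encK).

Definition concl (t : tree) : form :=
  match t with Asm A _ | Axm A _ | Node A _ _ => A end.

Definition below (s : seq nat) : seq nat := [seq k.-1 | k <- s & 0 < k].

(* The assumptions undischarged in [t], with their identifying index. *)
Fixpoint open_asms (t : tree) : seq (form * nat) :=
  match t with
  | Asm A k => [:: (A, k)]
  | Axm _ _ => [::]
  | Node _ _ ts =>
      [seq (p.1, p.2.-1) | p <- flatten (map open_asms ts) & 0 < p.2]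
  end.

(* The values outside of [t] of the functions h and g. *)
Fixpoint open_rules (t : tree) : seq nat :=
  match t with
  | Asm _ _ => [::]
  | Axm _ d => seq_of_opt d
  | Node _ d ts => seq_of_opt d ++ below (flatten (map open_rules ts))
  end.

Definition closed (t : tree) : bool := open_asms t == [::].

(* In the last conjunct, the node has its K in the domain of g, or is itself a
   value of h or g. *)
Fixpoint wf (t : tree) : bool :=
  match t with
  | Asm _ _ => true
  | Axm A d => (d != None) ==> atomic A
  | Node A d ts =>
      [&& 0 < size ts, all wf ts &
          (d != None) || (0 \in flatten (map open_rules ts)) ==>
          [&& atomic A, all (fun t => atomic (concl t)) ts &
              0 \notin map snd (flatten (map open_asms ts))]]
  end.

(* [wf] alone characterizes sub-structures of argument structures. *)
Definition is_structure (t : tree) : bool := wf t && (open_rules t == [::]).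

Definition from_to (t : tree) (G : seq form) (A : form) : Prop :=
  map fst (open_asms t) =i G /\ concl t = A.

Definition upn (f : nat -> nat) (k : nat) : nat :=
  if k is k'.+1 then (f k').+1 else 0.

Definition upm (f : nat -> option nat) (k : nat) : option nat :=
  if k is k'.+1 then omap S (f k') else Some 0.

(* [f] acts on the indices of undischarged assumptions and [m] on the outer
   values of h and g, the value [None] cancelling the discharge. *)
Fixpoint rename (f : nat -> nat) (m : nat -> option nat) (t : tree) : tree :=
  match t with
  | Asm A k => Asm A (f k)
  | Axm A d => Axm A (obind m d)
  | Node A d ts => Node A (obind m d) (map (rename (upn f) (upm m)) ts)
  end.

Definition shift : tree -> tree := rename S (fun k => Some k.+1).

Definition ups (s : form -> nat -> tree) (A : form) (k : nat) : tree :=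
  if k is k'.+1 then shift (s A k') else Asm A 0.

(* The result of replacing the undischarged assumptions of [t] according to
   [s]; nothing in the replacing structures gets discharged in [t]. *)
Fixpoint subst (s : form -> nat -> tree) (t : tree) : tree :=
  match t with
  | Asm A k => s A k
  | Axm A d => Axm A d
  | Node A d ts => Node A d (map (subst (ups s)) ts)
  end.

(** * Derivations in a base *)

(* [deriv B c t]: [t] is a derivation in [B] from assumed rules, where [nth c k]
   lists the rules discharged, in the branch containing [t], at the [k]-th node
   below the root of [t].  A node stands for an application of the rule [R]; the
   rule is either in [B], or assumed and discharged at the node pointed to. *)
Definition applicable (B : arule -> Prop) (c : seq (seq arule))
    (d : option nat) (R : arule) : Prop :=
  if d is Some k then has (same_rule R) (nth [::] c k) else B R.

Inductive deriv (B : arule -> Prop) : seq (seq arule) -> tree -> Prop :=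
| deriv_axiom c a d :
    applicable B c d (ARule [::] a) -> deriv B c (Axm (Atom a) d)
| deriv_rule c a d ps ts :
    0 < size ps -> applicable B c d (ARule ps a) -> size ts = size ps ->
    (forall i, i < size ps ->
       concl (nth (Axm (Atom bot) None) ts i) = Atom (nth ([::], bot) ps i).2) ->
    (forall i, i < size ps ->
       deriv B ((nth ([::], bot) ps i).1 :: c)
               (nth (Axm (Atom bot) None) ts i)) ->
    deriv B c (Node (Atom a) d ts).

Definition closed_derivation (B : base) (t : tree) : Prop := deriv B [::] t.

Definition derivable (B : base) (a : atom) : Prop :=
  exists2 t, closed_derivation B t & concl t = Atom a.

(** * Standard base semantics *)

Fixpoint sat (n : nat) (B : base) (F : form) {struct F} : Prop :=
  match F with
  | Atom a => derivable B a
  | And X Y => sat n B X /\ sat n B Y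
  | Or X Y => sat n B X \/ sat n B Y
  | Imp X Y => forall C, extends n B C -> sat n C X -> sat n C Y
  end.

(** * Sandqvist's base semantics *)

(* In the clause for disjunction, [sat_s n E (Atom d)] is [derivable E d]. *)
Fixpoint sat_s (n : nat) (B : base) (F : form) {struct F} : Prop :=
  match F with
  | Atom a => derivable B a
  | And X Y => sat_s n B X /\ sat_s n B Y
  | Or X Y => forall (C : base) (d : atom), extends n B C ->
      (forall E, extends n C E -> sat_s n E X -> derivable E d) ->
      (forall E, extends n C E -> sat_s n E Y -> derivable E d) ->
      derivable C d
  | Imp X Y => forall C, extends n B C -> sat_s n C X -> sat_s n C Y
  end.

Definition entails (V : nat -> base -> form -> Prop)
    (n : nat) (B : base) (G : seq form) (A : form) : Prop :=
  if G is [::] then V n B A else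
  forall C, extends n B C -> (forall F, F \in G -> V n C F) -> V n C A.

(** * Reducibility semantics *)

(* <D_1,...,D_m> and A; the discharges delta are carried by the indices in the
   D_i pointing to the new root. *)
Definition inference : Type := (seq tree * form)%type.

Definition instance_of (R : inference -> Prop) (t : tree) : Prop :=
  if t is Node A _ ts then R (ts, A) else False.

Definition is_subst (s : form -> nat -> tree) : Prop :=
  forall A k, wf (s A k) /\ concl (s A k) = A.

(* [phi] is applied to sub-structures of larger structures, where the outer
   values of h and g are recorded by indices; the last clause says that these
   only serve to trace the surviving or copied assumed rules.  For assumptions
   this follows from commutation with [subst]. *)
Definition reduction_for (R : inference -> Prop)
    (phi : tree -> option tree) : Prop :=
  forall t u, phi t = Some u ->
  [/\ wf t /\ instance_of R t,
      wf u,
      {subset open_asms u <= open_asms t} /\ concl u = concl t,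
      forall s, is_subst s -> phi (subst s t) = Some (subst s u) &
      forall m, phi (rename id m t) = Some (rename id m u)].

Definition reduction (phi : tree -> option tree) : Prop :=
  exists2 R, recursive R & reduction_for R phi.

Definition redset : Type := (tree -> option tree) -> Prop.

Definition reductions (J : redset) : Prop := forall phi, J phi -> reduction phi.

Inductive step (J : redset) : tree -> tree -> Prop :=
| step_here phi t u : J phi -> phi t = Some u -> step J t u
| step_sub A d ts t u us :
    step J t u -> step J (Node A d (ts ++ t :: us)) (Node A d (ts ++ u :: us)).

Definition reduces (J : redset) : tree -> tree -> Prop :=
  clos_refl_trans tree (step J).

Definition root_discharge (t : tree) (P : pred form) : bool :=
  all (fun p => (p.2 == 0) ==> P p.1) (open_asms t).

(* A node with a non-atomic label has no value of g. *)
Definition canonical (t : tree) : bool :=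
  match t with
  | Node (And X Y) None [:: t1; t2] =>
      [&& concl t1 == X, concl t2 == Y,
          root_discharge t1 pred0 & root_discharge t2 pred0]
  | Node (Or X Y) None [:: t1] =>
      ((concl t1 == X) || (concl t1 == Y)) && root_discharge t1 pred0
  | Node (Imp X Y) None [:: t1] =>
      (concl t1 == Y) && root_discharge t1 (pred1 X)
  | _ => false
  end.

(* Validity of a structure [t], closed or open, in terms of the validity [V] of
   closed structures with its conclusion and the validity [U F] of closed
   structures for its undischarged assumptions [F]. *)
Definition valid_by (n : nat) (U : form -> base -> redset -> tree -> Prop)
    (V : base -> redset -> tree -> Prop)
    (B : base) (J : redset) (t : tree) : Prop :=
  if closed t then V B J t else
  forall (s : form -> nat -> tree) (J' : redset) (C : base),
    (forall F k, (F, k) \in open_asms t ->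
       [/\ is_structure (s F k), closed (s F k) & concl (s F k) = F]) ->
    reductions J' -> (forall phi, J phi -> J' phi) -> extends n B C ->
    (forall F k, (F, k) \in open_asms t -> U F C J' (s F k)) ->
    V C J' (subst s t).

(* Validity of closed structures with conclusion [F].  In the last case the
   undischarged assumptions of [t1] are all [X], by [canonical]. *)
Fixpoint valid_closed (n : nat) (F : form) (B : base) (J : redset) (t : tree)
    {struct F} : Prop :=
  match F with
  | Atom _ => exists2 u, reduces J t u & closed_derivation B u
  | And X Y => exists t1 t2, let u := Node F None [:: t1; t2] in
      [/\ reduces J t u, canonical u,
          valid_closed n X B J t1 & valid_closed n Y B J t2]
  | Or X Y => exists t1, let u := Node F None [:: t1] in
      [/\ reduces J t u, canonical u &
          (concl t1 = X /\ valid_closed n X B J t1) \/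
          (concl t1 = Y /\ valid_closed n Y B J t1)]
  | Imp X Y => exists t1, let u := Node F None [:: t1] in
      [/\ reduces J t u, canonical u &
          valid_by n (fun _ => valid_closed n X) (valid_closed n Y) B J t1]
  end.

Definition valid (n : nat) (B : base) (J : redset) (t : tree) : Prop :=
  valid_by n (valid_closed n) (valid_closed n (concl t)) B J t.

Definition entails_red (n : nat) (B : base) (G : seq form) (A : form) : Prop :=
  exists t J, [/\ is_structure t, from_to t G A, reductions J & valid n B J t].

Inductive semantics : Type := Standard | Reducibility | Sandqvist.

Definition consequence (s : semantics) :
    nat -> base -> seq form -> form -> Prop :=
  match s with
  | Standard => entails sat
  | Reducibility => entails_red
  | Sandqvist => entails sat_s
  end.

(** * Systems *)

(* [([:: (D_1, A_1); ...; (D_m, A_m)], A)] is the schematic rule inferring A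
   from A_1,...,A_m and discharging the assumptions D_i in the derivation of
   A_i; its instances are obtained by substituting formulas for letters. *)
Definition schema : Type := (seq (seq form * form) * form)%type.

(* Extended derivations from assumptions in [G] with undischarged atomic rules
   in [X]. *)
Inductive ext_derives (Sigma : schema -> Prop) :
    (arule -> Prop) -> seq form -> form -> Prop :=
| ext_asm X G A : A \in G -> ext_derives Sigma X G A
| ext_logical X G (r : schema) (s : nat -> form) :
    Sigma r ->
    (forall p, p \in r.1 ->
       ext_derives Sigma X (map (fsubst s) p.1 ++ G) (fsubst s p.2)) ->
    ext_derives Sigma X G (fsubst s r.2)
| ext_atomic (X : arule -> Prop) G ps a :
    X (ARule ps a) ->
    (forall i, i < size ps ->
       ext_derives Sigma
         (fun R => X R \/ has (same_rule R) (nth ([::], bot) ps i).1)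
         G (Atom (nth ([::], bot) ps i).2)) ->
    ext_derives Sigma X G (Atom a).

Definition derives (Sigma : schema -> Prop) : seq form -> form -> Prop :=
  ext_derives Sigma (fun _ => False).

Definition IL : seq schema :=
  let p := Atom (Some 0) in let q := Atom (Some 1) in let r := Atom (Some 2) in
  [:: ([:: ([::], p); ([::], q)], And p q);
      ([:: ([::], And p q)], p);
      ([:: ([::], And p q)], q);
      ([:: ([::], p)], Or p q);
      ([:: ([::], q)], Or p q);
      ([:: ([::], Or p q); ([:: p], r); ([:: q], r)], r);
      ([:: ([:: p], q)], Imp p q);
      ([:: ([::], Imp p q); ([::], p)], q);
      ([:: ([::], Atom bot)], p)].

(* The last field says that [derives] is closed under the rules of IL, which
   need not be primitive. *)
Record system : Type := System {
  sys_rules :> schema -> Prop;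
  sys_recursive : recursive sys_rules;
  sys_superint : forall (r : schema) (s : nat -> form) (G : seq form),
    r \in IL ->
    (forall p, p \in r.1 ->
       derives sys_rules (map (fsubst s) p.1 ++ G) (fsubst s p.2)) ->
    derives sys_rules G (fsubst s r.2)
}.

Definition base_complete (s : semantics) (n : nat) (Sigma : system) : Prop :=
  forall (B : base) (G : seq form) (A : form), in_level n B ->
    consequence s n B G A -> ext_derives Sigma B G A.

Definition base_sound (s : semantics) (n : nat) (Sigma : system) : Prop :=
  forall (B : base) (G : seq form) (A : form), in_level n B ->
    ext_derives Sigma B G A -> consequence s n B G A.

(** * Compact export and Harrop's rule *)

Fixpoint conj (F : form) (s : seq form) : form :=
  if s is G :: s' then And F (conj G s') else F.

Definition conj_imp (s : seq form) (A : form) : form :=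
  if s is F :: s' then Imp (conj F s') A else A.

Fixpoint star (R : arule) : form :=
  let: ARule ps a := R in
  conj_imp (map (fun p => conj_imp (map star p.1) (Atom p.2)) ps) (Atom a).

Definition compact_export (Sigma : system) : Prop :=
  forall (B : base) (G : seq form) (A : form),
    ext_derives Sigma B G A <->
    exists2 D : seq form,
      (forall F, F \in D -> exists2 R, B R & F = star R) &
      derives Sigma (G ++ D) A.

Definition derives_harrop (Sigma : system) : Prop :=
  forall A B C : form,
    derives Sigma [:: Imp (Neg A) (Or B C)]
      (Or (Imp (Neg A) B) (Imp (Neg A) C)).

(* Main.v *)
From mathcomp Require Import all_boot.
From Stdlib Require Import Relations.
Require Import Defs.

(** Suppose that the system is base-complete.  Take the base whose axioms are
    all the letters except the first [k].  By completeness and compact export,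
    a consequence over this base between formulas in the first [k] letters is
    derivable in the system from finitely many explosion formulas and asserted
    letters.  Derivability is closed under substitution, so these letters can be
    replaced by a theorem and the first [k] by arbitrary formulas: the
    consequence becomes a derivable schema ([complete_derives]).  It remains to
    find, over this level-0 base and for every [n], a consequence with atomic
    parameters whose schema yields Harrop's rule.

    For the standard semantics, p -> q \/ r entails (p -> q) \/ (p -> r) when
    p, q, r are atoms: add the axiom p to the base, see which of q and r becomes
    derivable, and cut p ([sat_atomic_split]).  Putting the formulas ~ A, B, C
    for p, q, r gives Harrop's rule.

    The reducibility semantics validates the same consequence.  Among all
    reductions there is one taking a given closed structure that ends with an
    inference to any other given closed structure with the same conclusion, so
    with the set of all reductions such a structure is valid iff its conclusion
    holds in the standard semantics ([valid_closed_sat]).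

    In Sandqvist's semantics, a disjunction is defined by quantifying over the
    atoms.  With [k = 2] the only ones that matter are p, q and bottom, and
    their instances of the clause show that (q -> p) -> p, (p -> q) -> q and
    ~ (~ p /\ ~ q) entail p \/ q ([sat_s_or]).  For p := B -> C and
    q := C -> B these premises are intuitionistic theorems, so the system
    derives (B -> C) \/ (C -> B), from which Harrop's rule follows
    ([linear_harrop]). *)

Set Implicit Arguments.
Unset Strict Implicit.
Unset Printing Implicit Defensive.

(** * Derivability in a system *)

Lemma ext_derives_weaken (Sigma : schema -> Prop) X G G' A :
  ext_derives Sigma X G A -> {subset G <= G'} -> ext_derives Sigma X G' A.
Proof.
move=> d; elim: d G' => {X G A}
  [X G A GA|X G r s Sr _ IH|X G ps a Xr _ IH] G' sub.
- exact/ext_asm/sub.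
- apply: ext_logical Sr _ => p pr; apply: (IH p pr) => F.
  by rewrite !mem_cat => /orP[->//|/sub->]; rewrite orbT.
- by apply: ext_atomic Xr _ => i lti; apply: IH.
Qed.

Lemma derives_weaken (Sigma : schema -> Prop) G G' A :
  derives Sigma G A -> {subset G <= G'} -> derives Sigma G' A.
Proof. exact: ext_derives_weaken. Qed.

(** Stated without atomic rules, so that the derivations from [G'] need not be
    transported to sets of atomic rules enlarged by discharged ones. *)
Lemma derives_cut (Sigma : schema -> Prop) G G' A :
  derives Sigma G A -> (forall F, F \in G -> derives Sigma G' F) ->
  derives Sigma G' A.
Proof.
rewrite /derives; set X := fun _ => False => d; have X0 R : ~ X R by [].
elim: d X0 G' => {G A} {}X G => [A GA|r s Sr _ IH|ps a Xr _ _] X0 G' hG.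
- exact: hG.
- apply: ext_logical Sr _ => p pr; apply: (IH p pr) => // F.
  rewrite mem_cat => /orP[pF|/hG d].
    by apply: ext_asm; rewrite mem_cat pF.
  by apply: ext_derives_weaken d _ => H; rewrite mem_cat => ->; rewrite orbT.
- by case: (X0 _ Xr).
Qed.

Lemma fsubst_comp s s' F : fsubst s' (fsubst s F) = fsubst (fsubst s' \o s) F.
Proof.
by elim: F => [[k|]|X IHX Y IHY|X IHX Y IHY|X IHX Y IHY] //=; rewrite IHX IHY.
Qed.

Lemma derives_subst (Sigma : schema -> Prop) s G A :
  derives Sigma G A -> derives Sigma (map (fsubst s) G) (fsubst s A).
Proof.
rewrite /derives; set X := fun _ => False => d; have X0 R : ~ X R by [].
elim: d X0 => {G A} {}X G => [A GA|r s' Sr _ IH|ps a Xr _ _] X0.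
- exact/ext_asm/map_f.
- rewrite fsubst_comp; apply: ext_logical Sr _ => p pr.
  have := IH p pr X0; rewrite map_cat -map_comp fsubst_comp.
  by rewrite (eq_map (fsubst_comp s' s)).
- by case: (X0 _ Xr).
Qed.

Section NaturalDeduction.

Variable Sigma : system.
Implicit Types (G : seq form) (A B C : form).

Lemma nd_asm G A : A \in G -> derives Sigma G A.
Proof. exact: ext_asm. Qed.

(** The [i]-th rule of [IL], with the entries of [fs] for the letters. *)
Lemma superint_nth (i : nat) (fs G : seq form) :
  i < size IL ->
  let r := nth ([::], Atom bot) IL i in
  let f := fsubst (nth (Atom bot) fs) in
  (forall p, p \in r.1 -> derives Sigma (map f p.1 ++ G) (f p.2)) ->
  derives Sigma G (f r.2).
Proof. by move=> lti r f; apply: sys_superint; apply: mem_nth. Qed.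

Lemma nd_andE1 G A B : derives Sigma G (And A B) -> derives Sigma G A.
Proof.
move=> d; apply: (superint_nth (i := 1) (fs := [:: A; B])) => //.
by move=> p; rewrite !inE => /eqP->.
Qed.

Lemma nd_andE2 G A B : derives Sigma G (And A B) -> derives Sigma G B.
Proof.
move=> d; apply: (superint_nth (i := 2) (fs := [:: A; B])) => //.
by move=> p; rewrite !inE => /eqP->.
Qed.

Lemma nd_orI1 G A B : derives Sigma G A -> derives Sigma G (Or A B).
Proof.
move=> d; apply: (superint_nth (i := 3) (fs := [:: A; B])) => //.
by move=> p; rewrite !inE => /eqP->.
Qed.

Lemma nd_orI2 G A B : derives Sigma G B -> derives Sigma G (Or A B).
Proof.
move=> d; apply: (superint_nth (i := 4) (fs := [:: A; B])) => //.
by move=> p; rewrite !inE => /eqP->.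
Qed.

Lemma nd_orE G A B C :
  derives Sigma G (Or A B) -> derives Sigma (A :: G) C ->
  derives Sigma (B :: G) C -> derives Sigma G C.
Proof.
move=> d dA dB.
apply: (superint_nth (i := 5) (fs := [:: A; B; C])) => //.
by move=> p; rewrite !inE => /or3P[]/eqP->.
Qed.

Lemma nd_impI G A B : derives Sigma (A :: G) B -> derives Sigma G (Imp A B).
Proof.
move=> d; apply: (superint_nth (i := 6) (fs := [:: A; B])) => //.
by move=> p; rewrite !inE => /eqP->.
Qed.

Lemma nd_impE G A B :
  derives Sigma G (Imp A B) -> derives Sigma G A -> derives Sigma G B.
Proof.
move=> dI dA; apply: (superint_nth (i := 7) (fs := [:: A; B])) => //.
by move=> p; rewrite !inE => /orP[]/eqP->.
Qed.

Lemma nd_efq G A : derives Sigma G (Atom bot) -> derives Sigma G A.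
Proof.
move=> d; apply: (superint_nth (i := 8) (fs := [:: A])) => //.
by move=> p; rewrite !inE => /eqP->.
Qed.

End NaturalDeduction.

(** Closes a goal whose formula occurs among the assumptions. *)
Ltac nd_hyp := apply: nd_asm; rewrite !inE ?eqxx ?orbT.

(** * The base asserting almost all letters *)

Lemma same_explosion a S : same_rule (explosion a) S -> S = explosion a.
Proof.
case: S => [[|[rs c] [|q qs]] b] /=; rewrite ?andbF // andbT.
by case: rs => [|r rs] /=; rewrite ?andbF ?andbT // => /andP[/eqP-> /eqP<-].
Qed.

Lemma same_axiom a S : same_rule (ARule [::] a) S -> S = ARule [::] a.
Proof. by case: S => [[|? ?] b] /=; rewrite ?andbF // andbT => /eqP->. Qed.

Lemma derivable_axiom (B : base) a : B (ARule [::] a) -> derivable B a.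
Proof. by move=> Ba; exists (Axm (Atom a) None) => //; apply: deriv_axiom. Qed.

Section TailBase.

Variable k : nat.

(** The explosion rules, and as axioms the letters of index at least [k]; only
    bottom and the first [k] letters are left open. *)
Definition tail_rules (R : arule) : Prop :=
  (exists a, R = explosion a) \/ exists2 i, k <= i & R = ARule [::] (Some i).

Lemma tail_ext R S : same_rule R S -> tail_rules R -> tail_rules S.
Proof.
move=> RS [[a Ra]|[i ki Ri]]; [left; exists a|right; exists i => //].
  by apply: same_explosion; rewrite -Ra.
by apply: same_axiom; rewrite -Ri.
Qed.

Lemma tail_explosion a : tail_rules (explosion a).
Proof. by left; exists a. Qed.

(** The base with these rules; it has level 0. *)
Definition tail_base : base := Base tail_ext tail_explosion.

Lemma tail_base_level n : in_level n tail_base.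
Proof. by move=> R [|[i _ ->]]; [left|right]. Qed.

End TailBase.

(** A base-complete system derives the consequences over [tail_base (size fs)]
    as schemata.  [fs] lists the formulas put for the first [size fs] letters;
    the other letters, which the base asserts, are replaced by a theorem. *)
Lemma complete_derives (s : semantics) (n : nat) (Sigma : system)
    (fs G : seq form) (A : form) :
  compact_export Sigma -> base_complete s n Sigma ->
  consequence s n (tail_base (size fs)) G A ->
  let f := fsubst (nth (Neg (Atom bot)) fs) in derives Sigma (map f G) (f A).
Proof.
move=> expo compl cons f.
have [D Dstar /(derives_subst (nth (Neg (Atom bot)) fs)) dA] :=
  (expo _ _ _).1 (compl _ _ _ (@tail_base_level _ n) cons).
apply: derives_cut dA _ => F; rewrite map_cat mem_cat => /orP[|].
  exact: nd_asm.
case/mapP => {}F /Dstar[R [[a ->]|[i lei ->]] ->] -> /=.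
  by apply: nd_impI; apply: nd_efq; nd_hyp.
by rewrite nth_default //; apply: nd_impI; nd_hyp.
Qed.

(** * Derivations in a base *)

Lemma deriv_mono (B C : base) c t :
  (forall R, B R -> C R) -> deriv B c t -> deriv C c t.
Proof.
move=> BC; elim=> {c t} [c a d app|c a d ps ts ps0 app sz cc _ IH].
  by apply: deriv_axiom; case: d app => [k|] //=; apply: BC.
by apply: deriv_rule ps0 _ sz cc IH; case: d app => [k|] //=; apply: BC.
Qed.

Lemma derivable_mono (B C : base) a :
  (forall R, B R -> C R) -> derivable B a -> derivable C a.
Proof. by move=> BC [t dt ct]; exists t => //; apply: deriv_mono dt. Qed.

Lemma applicable_lt (B : base) c k R : applicable B c (Some k) R -> k < size c.
Proof. by rewrite /= ltnNge; apply: contraL => /(nth_default [::]) ->. Qed.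

Lemma applicable_cat (B : base) c c' d R :
  applicable B c d R -> applicable B (c ++ c') d R.
Proof.
by case: d => [k|] // app; rewrite /= nth_cat (applicable_lt app).
Qed.

(** The discharge indices in a derivation in context [c] do not reach beyond [c],
    so that [c] can be extended without renaming. *)
Lemma deriv_cat (B : base) c c' t : deriv B c t -> deriv B (c ++ c') t.
Proof.
elim=> {c t} [c a d app|c a d ps ts ps0 app sz cc _ IH].
  exact/deriv_axiom/applicable_cat.
exact: deriv_rule ps0 (applicable_cat _ app) sz cc IH.
Qed.

Lemma deriv_structure (B : base) c t : deriv B c t ->
  [/\ wf t, all (fun k => k < size c) (open_rules t) & open_asms t = [::]].
Proof.
have lt_size c0 d R : applicable B c0 d R ->
    all (fun k => k < size c0) (seq_of_opt d).
  by case: d => [k /applicable_lt|] //=; rewrite andbT.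
elim=> {c t} [c a d app|c a d ps ts ps0 app sz cc _ IH].
  by split=> //=; [rewrite implybT|apply: lt_size app].
pose t0 := Axm (Atom bot) None.
have {}IH t : t \in ts -> [/\ wf t, atomic (concl t),
    all (fun k => k < (size c).+1) (open_rules t) & open_asms t = [::]].
  move/(nthP t0) => [i lti <-]; rewrite sz in lti.
  by have [-> ? ?] := IH i lti; rewrite cc.
have asms0 : flatten (map open_asms ts) = [::].
  elim: ts IH {sz cc} => //= t ts IHts IH.
  have [_ _ _ ->] := IH t (mem_head _ _); apply: IHts => u uts.
  by apply: IH; rewrite inE uts orbT.
split; rewrite /= ?asms0 //.
  rewrite sz ps0 /= implybE orbC andbT.
  apply/andP; split; first by apply/allP => t /IH[].
  by apply/orP; left; apply/allP => t /IH[].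
rewrite all_cat (lt_size _ _ _ app) /=; apply/allP => _ /mapP[k + ->].
rewrite mem_filter => /andP[k0] /flattenP[_ /mapP[t /IH[_ _ + _] ->]].
by move=> /allP/[apply]; case: k k0.
Qed.

Section AddAxiom.

Variables (B : base) (a : atom).

Definition add_rules (R : arule) : Prop := B R \/ R = ARule [::] a.

Lemma add_ext R S : same_rule R S -> add_rules R -> add_rules S.
Proof.
move=> RS [BR|Ra]; first by left; apply: base_ext BR.
by right; apply: same_axiom; rewrite -Ra.
Qed.

Lemma add_explosion b : add_rules (explosion b).
Proof. by left; apply: base_explosion. Qed.

(** The base [B] with the atom [a] added as an axiom. *)
Definition add_axiom : base := Base add_ext add_explosion.

Lemma extends_add n : in_level n B -> extends n B add_axiom.
Proof. by move=> Bn; split=> [R|R [/Bn//|->]]; [left|right]. Qed.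

End AddAxiom.

Lemma derivable_add (B : base) a : derivable (add_axiom B a) a.
Proof. by apply: derivable_axiom; right. Qed.

(** Replacing the uses of the axiom [a] in a derivation by the structure [u]. *)
Fixpoint replace_axiom (a : atom) (u t : tree) : tree :=
  match t with
  | Axm A None => if A == Atom a then u else t
  | Node A d ts => Node A d (map (replace_axiom a u) ts)
  | _ => t
  end.

Lemma concl_replace_axiom a u t :
  concl u = Atom a -> concl (replace_axiom a u t) = concl t.
Proof. by move=> cu; case: t => // A [k|] //=; case: eqP => // ->. Qed.

Lemma deriv_replace_axiom (B C : base) a u c t :
  (forall R, B R -> C R) -> concl u = Atom a -> closed_derivation C u ->
  deriv (add_axiom B a) c t -> deriv C c (replace_axiom a u t).
Proof.
move=> BC cu du; elim=> {c t} [c b d app|c b d ps ts ps0 app sz cc _ IH].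
  case: d app => [k|] app; first exact: deriv_axiom.
  rewrite /=; case: eqP => [_|ba]; first exact: (deriv_cat c du).
  by apply: deriv_axiom; case: app => [/BC|[/(congr1 Atom)]].
apply: (deriv_rule (ps := ps)); rewrite ?size_map //.
- by case: d app => [k|] //= [/BC//|[ps_nil]]; rewrite ps_nil in ps0.
- move=> i lti; rewrite (nth_map (Axm (Atom bot) None)) ?sz //.
  by rewrite concl_replace_axiom ?cc.
- by move=> i lti; rewrite (nth_map (Axm (Atom bot) None)) ?sz //; apply: IH.
Qed.

(** If [b] is derivable once [a] is added to [B] as an axiom, then it is
    derivable in every extension of [B] that derives [a]. *)
Lemma derivable_cut (B C : base) a b :
  (forall R, B R -> C R) -> derivable (add_axiom B a) b -> derivable C a ->
  derivable C b.
Proof.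
move=> BC [t dt ct] [u du cu]; exists (replace_axiom a u t).
  exact: (deriv_replace_axiom BC).
by rewrite concl_replace_axiom.
Qed.

(** * Standard base semantics *)

Lemma extends_trans n B C D : extends n B C -> extends n C D -> extends n B D.
Proof. by move=> [BC _] [CD Dn]; split=> // R /BC/CD. Qed.

Lemma sat_mono n B C F : extends n B C -> sat n B F -> sat n C F.
Proof.
move=> BC; elim: F => [a|X IHX Y IHY|X IHX Y IHY|X _ Y _] /=.
- by apply: derivable_mono; case: BC.
- by move=> [/IHX ? /IHY ?].
- by move=> [/IHX|/IHY]; [left|right].
- by move=> h D CD; apply/h/(extends_trans BC).
Qed.

Section AtomicSplit.

Variables p q r : atom.

Lemma sat_atomic_split n B : in_level n B ->
  sat n B (Imp (Atom p) (Or (Atom q) (Atom r))) ->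
  sat n B (Or (Imp (Atom p) (Atom q)) (Imp (Atom p) (Atom r))).
Proof.
move=> Bn h; have [dq|dr] := h _ (extends_add p Bn) (derivable_add B p).
  by left=> C [BC _] dp; apply: derivable_cut dq dp.
by right=> C [BC _] dp; apply: derivable_cut dr dp.
Qed.

End AtomicSplit.

(** * Reducibility semantics *)

Lemma open_asms_rename f m t :
  open_asms (rename f m t) = [seq (p.1, f p.2) | p <- open_asms t].
Proof.
move: t f m; apply: (@tree_rect' _ (fun ts => forall f m,
  flatten (map open_asms (map (rename f m) ts)) =
  [seq (p.1, f p.2) | p <- flatten (map open_asms ts)])) => //=.
- move=> A d ts IH f m; rewrite IH filter_map -!map_comp.
  set l := flatten _; elim: l => //= [[F [|k]] l IHl] //=.
  by rewrite IHl.
- by move=> t ts IHt IHts f m; rewrite IHt IHts map_cat.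
Qed.

Lemma rename_fixed f m t :
  (forall p, p \in open_asms t -> f p.2 = p.2) ->
  (forall k, k \in open_rules t -> m k = Some k) -> rename f m t = t.
Proof.
move: t f m; apply: (@tree_rect' _ (fun ts => forall f m,
  (forall p, p \in flatten (map open_asms ts) -> f p.2 = p.2) ->
  (forall k, k \in flatten (map open_rules ts) -> m k = Some k) ->
  map (rename f m) ts = ts)) => //=.
- by move=> A k f m /(_ (A, k) (mem_head _ _)) /= ->.
- by move=> A [k|] f m _ // /(_ k (mem_head _ _)) /= ->.
- move=> A d ts IH f m hf hm; congr Node.
    by case: d hm => //= k /(_ k (mem_head _ _)).
  apply: IH => [[F [|k]] //= hk|[|k] //= hk].
    congr _.+1; apply: (hf (F, k)); apply/mapP; exists (F, k.+1) => //.
    by rewrite mem_filter.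
  rewrite hm // mem_cat; apply/orP; right; apply/mapP.
  by exists k.+1 => //; rewrite mem_filter.
- move=> t ts IHt IHts f m hf hm; congr (_ :: _).
    by apply: IHt => x hx; [apply: hf|apply: hm]; rewrite mem_cat hx.
  by apply: IHts => x hx; [apply: hf|apply: hm]; rewrite mem_cat hx orbT.
Qed.

Lemma subst_fixed s t :
  (forall p, p \in open_asms t -> s p.1 p.2 = Asm p.1 p.2) -> subst s t = t.
Proof.
move: t s; apply: (@tree_rect' _ (fun ts => forall s,
  (forall p, p \in flatten (map open_asms ts) -> s p.1 p.2 = Asm p.1 p.2) ->
  map (subst s) ts = ts)) => //=.
- by move=> A k s /(_ (A, k) (mem_head _ _)).
- move=> A d ts IH s hs; congr Node; apply: IH => [[F [|k]] //= hk].
  rewrite (hs (F, k)) //; apply/mapP; exists (F, k.+1) => //.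
  by rewrite mem_filter.
- move=> t ts IHt IHts s hs; congr (_ :: _).
    by apply: IHt => x hx; apply: hs; rewrite mem_cat hx.
  by apply: IHts => x hx; apply: hs; rewrite mem_cat hx orbT.
Qed.

(** The bound [j] accounts for the assumptions that [ups] leaves in place below
    a node; the case of interest is [j = 0]. *)
Lemma open_asms_subst j s t :
  (forall p, p \in open_asms t ->
     all (fun p => p.2 < j) (open_asms (s p.1 p.2))) ->
  all (fun p => p.2 < j) (open_asms (subst s t)).
Proof.
move: t j s; apply: (@tree_rect' _ (fun ts => forall j s,
  (forall p, p \in flatten (map open_asms ts) ->
     all (fun p => p.2 < j) (open_asms (s p.1 p.2))) ->
  all (fun p => p.2 < j) (flatten (map open_asms (map (subst s) ts))))) => //=.
- by move=> A k j s /(_ (A, k) (mem_head _ _)).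
- move=> A d ts IH j s hs.
  have {}IH : all (fun p => p.2 < j.+1)
      (flatten (map open_asms (map (subst (ups s)) ts))).
    apply: IH => [[F [|k]] //= hk]; rewrite open_asms_rename all_map.
    apply: (hs (F, k)); apply/mapP; exists (F, k.+1) => //.
    by rewrite mem_filter.
  apply/allP => _ /mapP[[F k] + ->]; rewrite mem_filter => /andP[/= k0].
  by move/(allP IH) => /=; case: k k0.
- move=> t ts IHt IHts j s hs; rewrite all_cat; apply/andP; split.
    by apply: IHt => x hx; apply: hs; rewrite mem_cat hx.
  by apply: IHts => x hx; apply: hs; rewrite mem_cat hx orbT.
Qed.

Lemma closed_subst s t :
  (forall F k, (F, k) \in open_asms t -> closed (s F k)) -> closed (subst s t).
Proof.
move=> hs; have : all (fun p => p.2 < 0) (open_asms (subst s t)).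
  by apply: open_asms_subst => [[F k] /hs/eqP ->].
by rewrite /closed; case: (open_asms _).
Qed.

Lemma concl_subst s t :
  (forall F k, (F, k) \in open_asms t -> concl (s F k) = F) ->
  concl (subst s t) = concl t.
Proof. by case: t => //= A k; apply; apply: mem_head. Qed.

(** Argument structures without undischarged assumptions; nothing in them refers
    to the outside, whence renamings and substitutions leave them unchanged. *)
Definition closed_structure (t : tree) : bool := is_structure t && closed t.

(** The structures ending with an inference. *)
Definition is_node (t : tree) : bool := if t is Node _ _ _ then true else false.

Lemma closed_structureP t :
  reflect [/\ wf t, open_rules t = [::] & open_asms t = [::]]
          (closed_structure t).
Proof.
apply: (iffP idP) => [/andP[/andP[-> /eqP->] /eqP->]|[wt rt at_]] //.
by rewrite /closed_structure /is_structure /closed wt rt at_.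
Qed.

Lemma closed_structure_deriv B t : closed_derivation B t -> closed_structure t.
Proof.
move=> /deriv_structure[wt + at_] ; rewrite /closed_structure /is_structure wt.
by rewrite /closed at_; case: (open_rules t).
Qed.

Lemma recursive_all (T : countType) : recursive (fun _ : T => True).
Proof.
exists (RComp RSucc [:: RZero]) => x; split=> [_|/(_ I)//].
apply: (@eval_comp _ _ _ [:: 0]) => // [[|] // _|]; last exact: eval_succ.
exact: eval_zero.
Qed.

(** As closed structures are unaffected by substitutions, any single one that
    ends with an inference may be reduced to any other with the same conclusion. *)
Lemma reduction_point t u :
  closed_structure t -> is_node t -> closed_structure u -> concl u = concl t ->
  reduction (fun v => if v == t then Some u else None).
Proof.
move=> /closed_structureP[wt rt at_] nt /closed_structureP[wu ru au] cu.
exists (fun _ => True); first exact: recursive_all.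
move=> v w; case: eqP => // -> [<-]; split=> //.
- by split=> //; case: (t) nt.
- by split=> //; rewrite au.
- by move=> s _; rewrite !subst_fixed ?eqxx ?at_ ?au.
- by move=> m; rewrite !rename_fixed ?eqxx ?rt ?ru.
Qed.

Lemma step_asms J t u : reductions J -> step J t u ->
  {subset open_asms u <= open_asms t} /\ concl u = concl t.
Proof.
move=> HJ; elim=> {t u} [phi t u Jphi tu|A d ts t u us _ [sub _]].
  by have [R _ /(_ _ _ tu)[]] := HJ _ Jphi.
split=> // x /mapP[p + ->]; rewrite mem_filter => /andP[p0 hp].
apply/mapP; exists p => //; rewrite mem_filter p0 /=; move: hp.
rewrite !map_cat !flatten_cat /= !mem_cat.
by case/or3P => [->//|/sub->|->]; rewrite !orbT.
Qed.

Lemma reduces_closed J t u : reductions J -> reduces J t u -> closed t ->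
  closed u /\ concl u = concl t.
Proof.
move=> HJ; elim=> {t u} [t u /(step_asms HJ)[sub ->]|//|t u v _ IH1 _ IH2].
  rewrite /closed => /eqP t0; rewrite t0 in sub; split=> //.
  by case: (open_asms u) sub => // x l /(_ x (mem_head _ _)).
by move=> /IH1[/IH2[cv ->] ->].
Qed.

(** [J] consists of all reductions.  The only set of reductions extending it is
    [J] itself, so that validity for open structures need not consider others. *)
Definition full (J : redset) : Prop := forall phi, J phi <-> reduction phi.

Lemma full_reductions J : full J -> reductions J.
Proof. by move=> fJ phi /fJ. Qed.

Lemma full_reduces J t u : full J ->
  closed_structure t -> is_node t -> closed_structure u -> concl u = concl t ->
  reduces J t u.
Proof.
move=> fJ ct nt cu ctu; apply/rt_step/step_here.
  exact/fJ/(reduction_point ct nt cu ctu).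
by rewrite /= eqxx.
Qed.

(** Structures with conclusion [F] whose only inference is arbitrary, the first
    closed and the second from [X].  Index 1, one more than the depth of the leaf
    allows, lets an inference placed immediately below the root discharge it. *)
Definition triv_closed (F : form) : tree := Node F None [:: Axm (Atom bot) None].
Definition triv_open (X F : form) : tree := Node F None [:: Asm X 1].

Lemma subst_triv_open s X F :
  closed_structure (s X 0) -> subst s (triv_open X F) = Node F None [:: s X 0].
Proof.
move=> /closed_structureP[_ r0 a0] /=; congr Node; congr (_ :: _).
by apply: rename_fixed; rewrite ?r0 ?a0.
Qed.

Lemma closed_structure_node1 t F :
  closed_structure t -> closed_structure (Node F None [:: t]).
Proof.
move=> /closed_structureP[wt rt at_]; apply/closed_structureP.
by rewrite /= wt rt at_.
Qed.

(** The assumptions left open in an immediate sub-structure of a closed structure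
    are discharged at the root. *)
Lemma closed_child A d ts t P p :
  closed (Node A d ts) -> t \in ts -> root_discharge t P ->
  p \in open_asms t -> P p.1.
Proof.
move=> /eqP/= cl tts /allP rd pt; apply: (implyP (rd p pt)).
apply/negPn/negP; rewrite -lt0n => p0.
suff: (p.1, p.2.-1) \in [::] by [].
rewrite -cl; apply/mapP; exists p => //; rewrite mem_filter p0.
by apply/flattenP; exists (open_asms t) => //; apply: map_f.
Qed.

Lemma closed_child0 A d ts t :
  closed (Node A d ts) -> t \in ts -> root_discharge t pred0 -> closed t.
Proof.
move=> cl tts rd; have := closed_child cl tts rd; rewrite /closed.
by case: (open_asms t) => // p l /(_ p (mem_head _ _)).
Qed.

(** With all reductions available, validity of closed structures amounts to the
    truth of the conclusion in the standard semantics.  The second half needs a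
    final inference, because a leaf cannot be reduced. *)
Lemma valid_closed_sat n F :
  forall J B, full J ->
    (forall t, concl t = F -> closed t -> valid_closed n F B J t -> sat n B F) /\
    (forall t, concl t = F -> closed_structure t -> is_node t ->
       sat n B F -> valid_closed n F B J t).
Proof.
elim: F => [a|X IHX Y IHY|X IHX Y IHY|X IHX Y IHY] J B fJ;
  have redJ := full_reductions fJ; split=> t ct clt /=.
- case=> u tu du; exists u => //.
  by have [_ ->] := reduces_closed redJ tu clt.
- move=> nt [u du cu]; exists u => //.
  by apply: full_reduces => //; [apply: closed_structure_deriv du|rewrite cu].
- case=> t1 [t2 [tu /and4P[/eqP c1 /eqP c2 rd1 rd2] v1 v2]].
  have [cu _] := reduces_closed redJ tu clt; split.
    apply: ((IHX J B fJ).1 t1) => //.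
    by apply: (closed_child0 cu) rd1; rewrite !inE eqxx.
  apply: ((IHY J B fJ).1 t2) => //.
  by apply: (closed_child0 cu) rd2; rewrite !inE eqxx orbT.
- move=> nt [sX sY]; exists (triv_closed X), (triv_closed Y); split.
  + by apply: full_reduces.
  + by rewrite /= !eqxx.
  + exact: (IHX J B fJ).2.
  + exact: (IHY J B fJ).2.
- case=> t1 [tu /andP[_ rd1] v1].
  have [cu _] := reduces_closed redJ tu clt.
  have cl1 : closed t1 by apply: (closed_child0 cu) rd1; rewrite !inE eqxx.
  case: v1 => -[c1 v1]; [left|right].
    exact: (IHX J B fJ).1 v1.
  exact: (IHY J B fJ).1 v1.
- move=> nt [sX|sY]; [exists (triv_closed X)|exists (triv_closed Y)]; split.
  + by apply: full_reduces.
  + by rewrite /= !eqxx.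
  + by left; split=> //; apply: (IHX J B fJ).2.
  + by apply: full_reduces.
  + by rewrite /= !eqxx orbT.
  + by right; split=> //; apply: (IHY J B fJ).2.
- case=> t1 [tu /andP[/eqP c1 rd1]] + C BC sX.
  have [cu _] := reduces_closed redJ tu clt.
  rewrite /valid_by; case: ifP => [cl1 v1|_ v1].
    by apply: sat_mono BC _; apply: (IHY J B fJ).1 v1.
  (* all assumptions of [t1] are [X]; they are replaced by [triv_closed X],
     which is valid on [C] because [X] holds there *)
  have asmX F k : (F, k) \in open_asms t1 -> F = X.
    by move=> h; apply/eqP/(closed_child cu _ rd1 h); rewrite inE.
  apply: ((IHY J C fJ).1 (subst (fun F _ => triv_closed F) t1)).
  + by rewrite concl_subst //= => F k /asmX.
  + by apply: closed_subst.
  + apply: v1 => // F k /asmX ->.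
    exact: (IHX J C fJ).2.
- move=> nt sXY; exists (triv_open X Y); split.
  + by apply: full_reduces.
  + by rewrite eqxx /root_discharge /= !eqxx.
  + rewrite /valid_by => s J' C hs redJ' JJ' BC vs.
    have [str cl cs] := hs X 0 (mem_head _ _).
    have fJ' : full J'.
      by move=> phi; split; [apply: redJ'|move/fJ; apply: JJ'].
    have stru : closed_structure (s X 0) by rewrite /closed_structure str.
    have sX : sat n C X.
      by apply: (IHX J' C fJ').1 (vs X 0 (mem_head _ _)).
    rewrite subst_triv_open //.
    by apply: (IHY J' C fJ').2; rewrite ?closed_structure_node1 //; apply: sXY.
Qed.

Lemma entails_red_sat n B X F :
  entails sat n B [:: X] F -> entails_red n B [:: X] F.
Proof.
move=> XF; have fJ : full reduction by [].
exists (triv_open X F), reduction; split=> //.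
rewrite /valid /valid_by => s J C hs redJ JJ BC vs.
have [str cl cs] := hs X 0 (mem_head _ _).
have {}fJ : full J by move=> phi; split; [apply: redJ|apply: JJ].
have stru : closed_structure (s X 0) by rewrite /closed_structure str.
rewrite subst_triv_open //.
apply: (valid_closed_sat n F C fJ).2; rewrite ?closed_structure_node1 //.
apply: XF => // G; rewrite inE => /eqP->.
exact: (valid_closed_sat n X C fJ).1 (vs X 0 (mem_head _ _)).
Qed.

(** * Sandqvist's semantics and linearity *)

Section Linearity.

Let p := Some 0 : atom.
Let q := Some 1 : atom.

(** The instances of Sandqvist's clause for the disjunction of [P] and [Q] at
    [P], [Q] and bottom, up to equivalence. *)
Definition or_premises (P Q : form) : seq form :=
  [:: Imp (Imp Q P) P; Imp (Imp P Q) Q; Neg (And (Neg P) (Neg Q))].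

Lemma sat_s_or n :
  entails sat_s n (tail_base 2) (or_premises (Atom p) (Atom q))
    (Or (Atom p) (Atom q)).
Proof.
move=> C BC prem D d CD pd qd.
have nth_prem i : i < 3 ->
    sat_s n C (nth (Atom bot) (or_premises (Atom p) (Atom q)) i).
  by move=> lti; apply: prem; apply: mem_nth.
have hp := nth_prem 0 isT.
have hq := nth_prem 1 isT.
have hbot := nth_prem 2 isT.
(* [D] derives every letter other than p and q outright *)
case: d pd qd => [[|[|i]]|] pd qd.
- exact: hp CD qd.
- exact: hq CD pd.
- apply: derivable_axiom; apply: (proj1 CD); apply: (proj1 BC).
  by right; exists i.+2.
- by apply: (hbot D CD); split.
Qed.

End Linearity.

Section Harrop.

Variable Sigma : system.
Implicit Types A B C : form.

(** For two converse implications, the premises are intuitionistic theorems. *)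
Lemma derives_or_premises A B G F :
  F \in or_premises (Imp A B) (Imp B A) -> derives Sigma G F.
Proof.
rewrite !inE => /or3P[]/eqP->.
- apply: nd_impI; apply: nd_impI; apply: nd_impE (nd_asm _ (mem_head _ _)).
  apply: (nd_impE (A := Imp B A)); first by nd_hyp.
  by apply: nd_impI; nd_hyp.
- apply: nd_impI; apply: nd_impI; apply: nd_impE (nd_asm _ (mem_head _ _)).
  apply: (nd_impE (A := Imp A B)); first by nd_hyp.
  by apply: nd_impI; nd_hyp.
- set H := And _ _; apply: nd_impI; apply: (nd_impE (A := Imp A B)).
    by apply: (nd_andE1 (B := Neg (Imp B A))); nd_hyp.
  apply: nd_impI; apply: nd_efq; apply: (nd_impE (A := Imp B A)).
    by apply: (nd_andE2 (A := Neg (Imp A B))); nd_hyp.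
  by apply: nd_impI; nd_hyp.
Qed.

(** If B -> C, then B \/ C yields C, and if C -> B, then it yields B. *)
Lemma linear_harrop :
  (forall A B, derives Sigma [::] (Or (Imp A B) (Imp B A))) ->
  derives_harrop Sigma.
Proof.
move=> lin A B C; apply: (nd_orE (derives_weaken (lin B C) _)) => //.
  apply: nd_orI2; apply: nd_impI; apply: (nd_orE (A := B) (B := C)).
  - by apply: (nd_impE (A := Neg A)); nd_hyp.
  - by apply: (nd_impE (A := B)); nd_hyp.
  - by nd_hyp.
apply: nd_orI1; apply: nd_impI; apply: (nd_orE (A := B) (B := C)).
- by apply: (nd_impE (A := Neg A)); nd_hyp.
- by nd_hyp.
- by apply: (nd_impE (A := C)); nd_hyp.
Qed.

End Harrop.

Theorem theorem19 (n : nat) (s : semantics) (Sigma : system) :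
  base_sound s n Sigma ->
  compact_export Sigma ->
  ~ derives_harrop Sigma ->
  ~ base_complete s n Sigma.
Proof.
move=> _ expo noharrop compl; apply: noharrop.
(* three letters, to be replaced by [Neg A], [B] and [C] *)
have split3 : entails sat n (tail_base 3)
    [:: Imp (Atom (Some 0)) (Or (Atom (Some 1)) (Atom (Some 2)))]
    (Or (Imp (Atom (Some 0)) (Atom (Some 1)))
        (Imp (Atom (Some 0)) (Atom (Some 2)))).
  move=> C [_ Cn] prem; apply: sat_atomic_split => //.
  exact: prem (mem_head _ _).
case: s compl => compl.
- move=> A B C.
  exact: (complete_derives (fs := [:: Neg A; B; C]) expo compl split3).
- have {}split3 := entails_red_sat split3; move=> A B C.
  exact: (complete_derives (fs := [:: Neg A; B; C]) expo compl split3).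
- apply: linear_harrop => A B.
  have := complete_derives (fs := [:: Imp A B; Imp B A]) expo compl
    (@sat_s_or n).
  by move/derives_cut; apply=> F; apply: derives_or_premises.
Qed.
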